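(* Consider the set of worst-case distributions $\mathcal{P}^*=\arg\sup_{\mathbb{P}\in\mathcal{P}_{(\mu,b,d)}}\mathbb{E}_{\mathbb{P}}[\mathbf{1}\{X\ge t\}]$. Then: (i) If $t\in[0,\tau_1]$, $\mathcal{P}^*=\{\mathbb{P}\in\mathcal{P}_{(\mu,b,d)} : \mathbb{P}(X\in[t,b])=1\}$, i.e. all distributions in $\mathcal{P}_{(\mu,b,d)}$ that are supported on the interval $[t,b]$. (ii) If $t\in[\tau_1,\mu]$, $$\mathcal{P}^*=\Big\{\mathbb{P} : \mathbb{P}(X=0)=1-\frac{\mu}{t}+\frac{d(b-t)}{2t(b-\mu)},\ \mathbb{P}(X=t)=\frac{\mu}{t}-\frac{bd}{2t(b-\mu)},\ \mathbb{P}(X=b)=\frac{d}{2(b-\mu)}\Big\},$$ i.e. a single three-point distribution. (iii) If $t\in[\mu,\tau_2]$, $$\mathcal{P}^*=\Big\{\mathbb{P}\in\mathcal{P}_{(\mu,b,d)} : \mathbb{P}(X=0)=\frac{d}{2\mu},\ \mathbb{P}(X\in[t,b])=1-\frac{d}{2\mu}\Big\},$$ i.e. all discrete/mixed distributions (in $\mathcal{P}_{(\mu,b,d)}$) with probability mass $\frac{d}{2\mu}$ on $0$ and the remainder of the probability mass supported on $[t,b]$. (iv) If $t\in[\tau_2,b]$, $$\mathcal{P}^*=\Big\{\mathbb{P}\in\mathcal{P}_{(\mu,b,d)} : \mathbb{P}(X=t)=\frac{d}{2(t-\mu)},\ \mathbb{P}(X\in[0,\mu])=1-\frac{d}{2(t-\mu)}\Big\},$$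 i.e. all discrete/mixed distributions (in $\mathcal{P}_{(\mu,b,d)}$) with probability mass $\frac{d}{2(t-\mu)}$ on $t$ and the remainder of the probability mass supported on $[0,\mu]$.
   Context: Let $\mu,b,d\in\mathbb{R}_+$. $\mathcal{P}_{(\mu,b,d)}$ is the set of all probability measures $\mathbb{P}$ on the Borel $\sigma$-algebra of $[0,b]$ (distributions of a random variable $X$) such that $\mathbb{P}(X\in[0,b])=1$, $\mathbb{E}_{\mathbb{P}}[X]=\mu$ and $\mathbb{E}_{\mathbb{P}}[|X-\mu|]=d$. Here $\mathbf{1}\{\cdot\}$ is the indicator function, and $\arg\sup$ denotes the set of measures attaining the supremum. The thresholds are $\tau_1=\mu-\frac{d(b-\mu)}{2(b-\mu)-d}$ and $\tau_2=\mu+\frac{d\mu}{2\mu-d}$.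
   Formalization: In (ii) equality is stated for t<μ only: at t=μ it is false (b=2, μ=1, d=1/2, t=1: mass 1/4 at 0, 3/4 at 4/3 is also optimal) and only ''the three-point law is worst-case'' is kept. Zero denominators are excluded: t>0 in (ii), μ>0 in (iii), t>μ in (iv). *)

(* Defs.v *)
From HB Require Import structures.
From mathcomp Require Export all_boot all_order all_algebra.
From mathcomp Require Export all_classical all_reals all_analysis.
Export Order.TTheory GRing.Theory Num.Theory numFieldNormedType.Exports.

#[global] Set Implicit Arguments.
#[global] Unset Strict Implicit.
#[global] Unset Printing Implicit Defensive.

Local Open Scope classical_set_scope.
Local Open Scope ring_scope.

Definition argsup (R : realType) (T : Type) (A : set T) (f : T -> \bar R) :
    set T :=
  [set x | A x /\ f x = ereal_sup (f @` A)].

(* A law on [0, b] is encoded as a Borel probability on the whole line giving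
   mass 1 to [0, b]; the random variable X is the identity of R.  A library
   measure is a function on all subsets of R, whose values off the Borel sets
   are irrelevant: two laws are therefore compared with same_law, never with
   Leibniz equality. *)
Definition law (R : realType) : Type := probability (measurableTypeR R) R.

Definition same_law (R : realType) (P Q : law R) : Prop :=
  forall A : set (measurableTypeR R), measurable A -> P A = Q A.

Definition laws_on (R : realType) (b : R) : set (law R) :=
  [set P : law R | P `[0, b]%classic = 1%E].

Definition ambiguity_set (R : realType) (mu b d : R) : set (law R) :=
  [set P : law R | [/\ laws_on b P,
                       ('E_P[fun x => x] = mu%:E)%E
                     & ('E_P[fun x => `|x - mu|%R] = d%:E)%E]].

Definition worst_case (R : realType) (mu b d t : R) : set (law R) :=
  argsup (ambiguity_set mu b d) (fun P : law R => 'E_P[\1_[set x | (t <= x)%R]]%E).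

Definition tau1 (R : realType) (mu b d : R) : R :=
  mu - d * (b - mu) / (2 * (b - mu) - d).

Definition tau2 (R : realType) (mu d : R) : R :=
  mu + d * mu / (2 * mu - d).

(* Mean and mean absolute deviation are not imposed: they follow from the three
   masses. *)
Definition three_point_laws (R : realType) (mu b d t : R) : set (law R) :=
  [set P : law R |
     [/\ laws_on b P,
         P [set 0] = (1 - mu / t + d * (b - t) / (2 * t * (b - mu)))%:E,
         P [set t] = (mu / t - b * d / (2 * t * (b - mu)))%:E
       & P [set b] = (d / (2 * (b - mu)))%:E]].

(* Main.v *)
Require Import Defs.
From mathcomp Require Import measurable_realfun ring lra.

(** The proof is linear programming duality. A function of the form
    x |-> a0 + a1 x + a2 |x - mu| has the same expectation
    a0 + a1 mu + a2 d under every law of the ambiguity set. When it dominates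
    the indicator of [t, b] on [0, b], this number bounds the tail probability
    P(X >= t), and a law attains the bound only if it is carried by the set
    where the function and the indicator agree. Both facts are [tail_duality],
    which rests on [ge0_expectation_slack].

    In each regime the dominating function F is piecewise linear with its only
    kink at mu:
    - t <= tau1: F = 1;
    - tau1 <= t <= mu: F vanishes at 0 and equals 1 at t and at b; for t < mu
      it agrees with the indicator at 0, t and b only;
    - mu <= t <= tau2: F(x) = min (x / mu) 1, which agrees with the indicator
      on {0} and [t, b];
    - tau2 <= t, mu < t: F(x) = max (x - mu) 0 / (t - mu), which agrees with the
      indicator on [0, mu] and {t}.

    It remains to see that the bound is attained as soon as the ambiguity set is
    nonempty. The witnesses are laws with atoms where F agrees with the
    indicator: [two_point_law] with atoms tau1 and b for t <= tau1, with 0 and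
    tau2 for mu <= t <= tau2, with t and a point of [0, mu] for tau2 <= t, and
    [three_point_law_exists] with 0, t and b in between. The thresholds are the
    values of t at which an atom would leave its interval or a weight would
    become negative. The other weights and atoms are in range because mu, b and
    d satisfy b d <= 2 mu (b - mu) ([mad_le]), itself an instance of duality,
    with the constant 0 in place of the indicator. In the three-point regime
    the extremal law is unique for t < mu: total mass, tail and mean determine
    the masses of a law carried by {0, t, b}. *)

Local Open Scope classical_set_scope.
Local Open Scope ring_scope.

(** * Laws with finitely many atoms *)

Lemma law_fineK (R : realType) (P : law R) (A : set (measurableTypeR R)) :
  measurable A -> P A = (fine (P A))%:E.
Proof. by move=> mA; rewrite fineK// fin_num_measure. Qed.

Definition atomic_measure (R : realType) (s : seq (R * {nonneg R})) :
    {measure set (measurableTypeR R) -> \bar R} :=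
  let atom i := nth (0, 0%:nng) s i in
  msum (fun i => mscale (atom i).2 (dirac ((atom i).1 : measurableTypeR R)))
       (size s).

(** Normalizing makes this a probability for every list of atoms; it changes
    nothing when the weights sum to 1. The Dirac mass at 0 is the default used
    when the total weight is 0. *)
Definition finite_law (R : realType) (s : seq (R * {nonneg R})) : law R :=
  mnormalize (atomic_measure s) (dirac (0 : measurableTypeR R)).

Section finite_law.
Variables (R : realType) (s : seq (R * {nonneg R})).
Hypothesis s1 : \sum_(p <- s) p.2%:num = 1.

Let atomic_measureE A :
  atomic_measure s A = (\sum_(p <- s) p.2%:num * \1_A p.1)%:E.
Proof.
rewrite (big_nth (0, 0%:nng)) big_mkord -sumEFin.
by apply: eq_bigr => i _.
Qed.

Lemma finite_lawE (A : set (measurableTypeR R)) :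
  finite_law s A = (\sum_(p <- s) p.2%:num * \1_A p.1)%:E.
Proof.
have m1 : atomic_measure s setT = 1%E.
  rewrite atomic_measureE -[1%E]/(1%:E) -s1; congr EFin.
  by apply: eq_bigr => p _; rewrite indicT mulr1.
rewrite -atomic_measureE /finite_law /= /mnormalize m1 onee_eq0/=.
by rewrite invr1 mule1.
Qed.

Let ge0_integral_atomic (f : measurableTypeR R -> \bar R) :
  measurable_fun setT f -> (forall x, 0 <= f x)%E ->
  (\int[atomic_measure s]_x f x = \sum_(p <- s) p.2%:num%:E * f p.1)%E.
Proof.
move=> mf f0; rewrite ge0_integral_measure_sum// [RHS](big_nth (0, 0%:nng)).
rewrite big_mkord; apply: eq_bigr => i _.
by rewrite ge0_integral_mscale// integral_dirac// diracT mul1e.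
Qed.

Lemma expectation_finite_law (f : measurableTypeR R -> R) :
  measurable_fun setT f ->
  ('E_(finite_law s)[f] = (\sum_(p <- s) p.2%:num * f p.1)%:E)%E.
Proof.
move=> mf; rewrite unlock (eq_measure_integral (atomic_measure s)); last first.
  by move=> A mA _; exact: etrans (finite_lawE A) (esym (atomic_measureE A)).
have mEf : measurable_fun setT (EFin \o f) by exact/measurable_EFinP.
rewrite integralE !ge0_integral_atomic//; last 2 first.
- exact: measurable_funeneg.
- exact: measurable_funepos.
rewrite funerpos funerneg -[in RHS](funrposBneg f).
rewrite -!(eq_bigr _ (fun p _ => EFinM _ _)) !sumEFin.
by rewrite -EFinB -sumrB; congr EFin; apply: eq_bigr => p _; rewrite -mulrBr.
Qed.

End finite_law.

(** Distinct atoms are disjoint, so they can be removed from A one at a time. *)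
Lemma ge_sum_atoms (R : realType) (P : law R) (s : seq (R * {nonneg R}))
    (A : set (measurableTypeR R)) : measurable A ->
  uniq (map fst s) -> (forall p, p \in s -> P [set p.1] = p.2%:num%:E) ->
  ((\sum_(p <- s) p.2%:num * \1_A p.1)%:E <= P A)%E.
Proof.
elim: s A => [|p s ih] A mA /=; first by rewrite big_nil.
case/andP => ps us Ps; rewrite big_cons.
have m1 : measurable ([set p.1] : set (measurableTypeR R)) by [].
have {}ih B : measurable B -> ((\sum_(q <- s) q.2%:num * \1_B q.1)%:E <= P B)%E.
  by move=> mB; apply: ih => // q qs; apply: Ps; rewrite in_cons qs orbT.
have [pA|pA] := boolP (p.1 \in A); last first.
  by rewrite indicE (negbTE pA) mulr0 add0r; exact: ih.
have -> : (P A = P [set p.1] + P (A `\` [set p.1]))%E.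
  rewrite -measureU//; last 2 first.
  - exact: measurableD.
  - exact: setDIK.
  by rewrite setDUK// => _ ->; exact: set_mem.
rewrite Ps ?mem_head// EFinD indicE pA mulr1 leeD2l//.
rewrite (le_trans _ (ih _ (measurableD mA m1)))// lee_fin.
rewrite big_seq [leRHS]big_seq; apply: ler_sum => q qs.
rewrite ler_wpM2l// !indicE in_setD.
rewrite (memNset (A := [set p.1])) ?andbT// => /= qp.
by move: ps; rewrite -qp map_f.
Qed.

(** The lower bound [ge_sum_atoms], applied to A and to its complement, leaves
    no room when the known masses already sum to 1. *)
Lemma same_law_finite_law (R : realType) (P : law R)
    (s : seq (R * {nonneg R})) :
  \sum_(p <- s) p.2%:num = 1 -> uniq (map fst s) ->
  (forall p, p \in s -> P [set p.1] = p.2%:num%:E) ->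
  same_law P (finite_law s).
Proof.
move=> s1 us Ps A mA; apply/eqP; rewrite eq_le; apply/andP; split; last first.
  by rewrite finite_lawE//; exact: ge_sum_atoms.
have := ge_sum_atoms (measurableC mA) us Ps.
rewrite -(finite_lawE s1) !probability_setC// (law_fineK P mA).
rewrite (law_fineK (finite_law s) mA) -!EFinB !lee_fin.
by rewrite lerD2l lerN2.
Qed.

Lemma same_law_expectation (R : realType) (P Q : law R)
    (f : measurableTypeR R -> R) :
  same_law P Q -> ('E_P[f] = 'E_Q[f])%E.
Proof.
by move=> PQ; rewrite unlock; apply: eq_measure_integral => A mA _; exact: PQ.
Qed.

(** * Duality *)

Lemma law_null_setC (R : realType) (P : law R) (D : set (measurableTypeR R)) :
  measurable D -> P D = 1%E -> P (~` D) = 0%E.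
Proof. by move=> mD PD; rewrite probability_setC// PD subee. Qed.

(** [measureU] with the coercions of a law, so that facts about P rewrite in the
    result. *)
Lemma law_measureU (R : realType) (P : law R)
    (A B : set (measurableTypeR R)) : measurable A -> measurable B ->
  A `&` B = set0 -> P (A `|` B) = (P A + P B)%E.
Proof. exact: measureU. Qed.

Lemma full_law_setI (R : realType) (P : law R)
    (D A : set (measurableTypeR R)) : measurable D -> measurable A ->
  P D = 1%E -> P (A `&` D) = P A.
Proof.
move=> mD mA PD; rewrite [RHS](measureDI _ mA mD) /=.
suff -> : P (A `\` D) = 0%E by rewrite add0e.
apply: (subset_measure0 _ _ _ (law_null_setC mD PD)) => //.
- exact: measurableD.
- exact: measurableC.
Qed.

(** Up to a null set g is its own absolute value, so a zero expectation forces g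
    to vanish almost everywhere: complementary slackness for one constraint. *)
Lemma ge0_expectation_slack (R : realType) (P : law R)
    (D : set (measurableTypeR R)) (g : measurableTypeR R -> R) :
  measurable D -> measurable_fun setT g -> P D = 1%E ->
  (forall x, D x -> 0 <= g x) ->
  (0 <= 'E_P[g])%E /\ (('E_P[g] = 0)%E -> P (D `&` [set x | g x = 0]) = 1%E).
Proof.
move=> mD mg PD g0.
have mEg : measurable_fun setT (EFin \o g) by exact/measurable_EFinP.
have Eg : ('E_P[g] = \int[P]_x `|(g x)%:E|)%E.
  rewrite unlock; apply: ae_eq_integral => //; first exact: measurableT_comp.
  exists (~` D); split; first exact: measurableC.
    exact: law_null_setC.
  move=> x /= nx Dx; apply: nx => _; rewrite ger0_norm//; exact: g0.
split; first by rewrite Eg; exact: integral_ge0.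
rewrite Eg => /ae_eq_integral_abs => /(_ measurableT mEg) [N [mN PN gN]].
have mg0 : measurable [set x | g x = 0].
  rewrite -[X in measurable X]setTI.
  exact: (mg measurableT [set 0]).
rewrite setIC full_law_setI// -[X in P X]setCK probability_setC; last first.
  exact: measurableC.
suff -> : P (~` [set x | g x = 0]) = 0%E by rewrite sube0.
apply: (subset_measure0 _ _ _ PN) => //; first exact: measurableC.
by move=> x gx; apply: gN => /= /(_ I) [].
Qed.

Lemma measurable_tail (R : realType) (t : R) :
  measurable ([set x | t <= x] : set (measurableTypeR R)).
Proof. by rewrite -set_itvcy; exact: measurable_itv. Qed.

Section ambiguity_set.
Variables (R : realType) (mu b d : R) (P : law R).
Hypothesis PA : ambiguity_set mu b d P.

Let PD : P `[0, b]%classic = 1%E. Proof. by case: PA. Qed.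

(* The law has a finite mean absolute deviation, so the deviation, and with it
   the identity, are integrable. *)
Let Ldev : ((fun x : measurableTypeR R => x - mu) : _ -> _) \in Lfun P 1.
Proof.
apply/Lfun1_integrable/integrableP; split.
  apply/measurable_EFinP; exact: measurable_funB.
by case: PA => _ _; rewrite unlock => /= ->; exact: ltry.
Qed.

Let Lid : ((fun x : measurableTypeR R => x) : _ -> _) \in Lfun P 1.
Proof.
have -> : (fun x : measurableTypeR R => x) =
          (fun x : measurableTypeR R => x - mu) + cst mu.
  by apply/funext => x /=; rewrite fctE subrK.
by rewrite rpredD//; exact: Lfun_cst.
Qed.

Let Lind (A : set (measurableTypeR R)) : measurable A ->
  (\1_A : _ -> R) \in Lfun P 1.
Proof.
move=> mA; apply/Lfun1_integrable.
by apply: integrable_indic => //; rewrite fin_num_fun_lty// fin_num_measure.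
Qed.

Lemma expectation_test (a0 a1 a2 c : R) (A : set (measurableTypeR R)) :
  measurable A ->
  ('E_P[fun x => (a0 + a1 * x + a2 * `|x - mu| - c * \1_A x)%R]
   = (a0 + a1 * mu + a2 * d - c * fine (P A))%:E)%E.
Proof.
move=> mA; case: PA => _ Emu Ed.
have -> : (fun x => a0 + a1 * x + a2 * `|x - mu| - c * \1_A x) =
  (((cst a0 \+ (a1 \o* (fun x : measurableTypeR R => x)))
   \+ (a2 \o* (Num.norm \o (fun x : measurableTypeR R => x - mu))))
   \- (c \o* \1_A)).
  by apply/funext => x /=; ring.
rewrite expectationB; last 2 first.
- rewrite !rpredD//; [exact: Lfun_cst|exact: Lfun_scale|].
  by apply: Lfun_scale => //; exact: Lfun_norm.
- by apply: Lfun_scale => //; exact: Lind.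
rewrite expectationD; last 2 first.
- by rewrite !rpredD//; [exact: Lfun_cst|exact: Lfun_scale].
- by apply: Lfun_scale => //; exact: Lfun_norm.
rewrite expectationD; last 2 first.
- exact: Lfun_cst.
- exact: Lfun_scale.
rewrite expectation_cst !expectationZl//; last 2 first.
- exact: Lind.
- exact: Lfun_norm.
by rewrite Emu Ed expectation_indic// (law_fineK P mA).
Qed.

Let measurable_test (a0 a1 a2 c : R) (A : set (measurableTypeR R)) :
  measurable A ->
  measurable_fun setT (fun x => a0 + a1 * x + a2 * `|x - mu| - c * \1_A x).
Proof.
move=> mA; apply: measurable_funB; last exact: measurable_funM.
apply: measurable_funD; first exact: measurable_funD.
apply: measurable_funM => //; apply: measurableT_comp => //.
exact: measurable_funB.
Qed.

(** Weak duality and complementary slackness. With c = 1 this bounds tail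
    probabilities; with c = 0 it yields the constraints on mu, b and d that hold
    as soon as the ambiguity set is inhabited. *)
Lemma tail_duality (a0 a1 a2 c t : R) :
  (forall x, 0 <= x <= b ->
     0 <= a0 + a1 * x + a2 * `|x - mu| - c * (t <= x)%R%:R) ->
  let v := a0 + a1 * mu + a2 * d in
  let p := fine (P [set x | (t <= x)%R]) in
  c * p <= v /\
  (c * p = v ->
   P [set x | 0 <= x <= b /\ a0 + a1 * x + a2 * `|x - mu| = c * (t <= x)%R%:R]
     = 1%E).
Proof.
move=> G0 v p.
have mT := measurable_tail t.
have mD : measurable (`[0, b]%classic : set (measurableTypeR R)).
  exact: measurable_itv.
have indT x : \1_[set x | t <= x] x = (t <= x)%R%:R :> R.
  by rewrite indicE; congr (nat_of_bool _)%:R; apply/idP/idP; rewrite inE.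
have [] := ge0_expectation_slack mD (measurable_test a0 a1 a2 c mT) PD.
  by move=> x; rewrite /= in_itv/= indT => /G0.
rewrite expectation_test// -/p -/v lee_fin subr_ge0 => pv slack; split=> // pv1.
rewrite -slack ?pv1 ?subrr//; congr (P _); apply/seteqP; split=> x /=.
  by rewrite in_itv/= indT => -[-> ->]; rewrite subrr.
by rewrite in_itv/= indT => -[-> /eqP]; rewrite subr_eq0 => /eqP.
Qed.

Lemma mean_le_ub : mu <= b.
Proof.
have [] := @tail_duality b (-1) 0 0 0; last by rewrite mul0r mul0r addr0; lra.
by move=> x /andP[x0 xb]; rewrite !mul0r; lra.
Qed.

(** |x - mu| lies below its chord on [0, b]; the two sides have these
    expectations, up to the factor b that clears the denominator. *)
Lemma mad_le (hmu : 0 <= mu) : b * d <= 2 * mu * (b - mu).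
Proof.
have := mean_le_ub => mub.
have [] := @tail_duality (b * mu) (b - 2 * mu) (- b) 0 0; last first.
  by rewrite mul0r; nra.
move=> x /andP[x0 xb]; rewrite !mul0r subr0.
have [xm|mx] := leP x mu.
  rewrite ler0_norm ?subr_le0//.
  have := mulr_ge0 x0 (_ : 0 <= b - mu); nra.
rewrite gtr0_norm ?subr_gt0//.
have := mulr_ge0 hmu (_ : 0 <= b - x); nra.
Qed.

(** The degenerate case b = mu, where d must vanish, is the reason for this
    bound: [mad_le] says nothing about d when b = mu = 0. The positive part of
    x - mu, of expectation d / 2, is at most b - mu. *)
Lemma mad_le_ub : d <= 2 * (b - mu).
Proof.
have [] := @tail_duality (2 * b - mu) (-1) (-1) 0 0; last by rewrite mul0r; lra.
have mub := mean_le_ub; move=> x /andP[x0 xb]; rewrite !mul0r subr0.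
by have [xm|mx] := leP x mu; [rewrite ler0_norm|rewrite gtr0_norm]; lra.
Qed.

(** The counterpart of [mad_le_ub] for the negative part; it settles mu = 0. *)
Lemma mad_le_lb (hmu : 0 <= mu) : d <= 2 * mu.
Proof.
have [] := @tail_duality mu 1 (-1) 0 0; last by rewrite mul0r; lra.
move=> x /andP[x0 xb]; rewrite !mul0r subr0.
by have [xm|mx] := leP x mu; [rewrite ler0_norm|rewrite gtr0_norm]; lra.
Qed.

End ambiguity_set.

Lemma tail_itv (R : realType) (b t : R) (P : law R) : laws_on b P -> 0 <= t ->
  P [set x | (t <= x)%R] = P `[t, b]%classic.
Proof.
move=> Pb t0; rewrite -(@full_law_setI _ _ `[0, b]%classic)//; last first.
  exact: measurable_tail.
congr (P _); apply/seteqP; split=> x /=; rewrite !in_itv/=.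
  by move=> [-> /andP[]].
by move=> /andP[tx xb]; rewrite tx (le_trans t0 tx) xb.
Qed.

Section worst_case.
Variables (R : realType) (mu b d t v : R).

Hypothesis ub : forall P, ambiguity_set mu b d P ->
  fine (P [set x | (t <= x)%R]) <= v.

Let tailE (P : law R) :
  ('E_P[\1_[set x | (t <= x)%R]] = (fine (P [set x | (t <= x)%R]))%:E)%E.
Proof.
have mT := measurable_tail t.
by rewrite expectation_indic// (law_fineK P mT).
Qed.

Lemma worst_case_of_bound P : ambiguity_set mu b d P ->
  fine (P [set x | (t <= x)%R]) = v -> worst_case mu b d t P.
Proof.
move=> AP Pv; split=> //; apply/eqP; rewrite eq_le; apply/andP; split.
  by apply: ereal_sup_ubound; exists P.
apply: ge_ereal_sup => _ [Q AQ <-].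
by rewrite !tailE Pv lee_fin; exact: ub.
Qed.

(** When the ambiguity set is empty both sides are; this is why S is only
    required to be inhabited together with it. *)
Lemma worst_case_eq (S : set (law R)) :
  S `<=` ambiguity_set mu b d ->
  (ambiguity_set mu b d !=set0 -> S !=set0) ->
  (forall P, ambiguity_set mu b d P ->
     fine (P [set x | (t <= x)%R]) = v <-> S P) ->
  worst_case mu b d t = S.
Proof.
move=> SA neS SE; apply/seteqP; split=> P; last first.
  move=> SP; apply: worst_case_of_bound; first exact: SA.
  by apply/SE => //; exact: SA.
move=> [AP Psup]; apply/SE => //.
have [Q SQ] : S !=set0 by apply: neS; exists P.
apply/eqP; rewrite eq_le ub//=.
have /SE[_ /(_ SQ) <-] := SA _ SQ.
by rewrite -lee_fin -!tailE Psup; apply: ereal_sup_ubound; exists Q => //;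
   exact: SA.
Qed.

End worst_case.

(** * The four regimes *)

Lemma finite_law_ambiguity (R : realType) (mu b d : R)
    (s : seq (R * {nonneg R})) :
  \sum_(p <- s) p.2%:num = 1 -> (forall p, p \in s -> 0 <= p.1 <= b) ->
  \sum_(p <- s) p.2%:num * p.1 = mu ->
  \sum_(p <- s) p.2%:num * `|p.1 - mu| = d ->
  ambiguity_set mu b d (finite_law s).
Proof.
move=> s1 sb smu sd; split.
- rewrite /laws_on /= finite_lawE//; congr EFin; rewrite -[RHS]s1.
  rewrite big_seq [RHS]big_seq; apply: eq_bigr => p ps.
  by rewrite indicE mem_set ?mulr1//= in_itv/= sb.
- by rewrite expectation_finite_law// smu.
- rewrite expectation_finite_law ?sd//.
  by apply: measurableT_comp => //; exact: measurable_funB.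
Qed.

(** With x <= mu <= y and mean mu, the deviations above and below mu have equal
    expectations, so the mean absolute deviation is twice the upper part. *)
Lemma two_point_law (R : realType) (mu b d q x y : R) :
  0 <= q <= 1 -> 0 <= x <= mu -> mu <= y <= b ->
  (1 - q) * x + q * y = mu -> 2 * q * (y - mu) = d ->
  exists2 P : law R, ambiguity_set mu b d P &
    forall A, P A = ((1 - q) * \1_A x + q * \1_A y)%:E.
Proof.
move=> /andP[q0 q1] /andP[x0 xmu] /andP[muy yb] qmu qd.
have q1' : 0 <= 1 - q by rewrite subr_ge0.
pose s : seq (R * {nonneg R}) := [:: (x, NngNum q1'); (y, NngNum q0)].
have s1 : \sum_(p <- s) p.2%:num = 1 by rewrite !big_cons big_nil/=; lra.
exists (finite_law s); last first.
  by move=> A; rewrite finite_lawE// !big_cons big_nil/= addr0.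
apply: finite_law_ambiguity => //.
- move=> p; rewrite !inE => /orP[] /eqP ->/=; lra.
- by rewrite !big_cons big_nil/=; lra.
- rewrite !big_cons big_nil/= ler0_norm ?subr_le0// ger0_norm ?subr_ge0//; lra.
Qed.

Section cases.
Variables (R : realType) (mu b d : R).
Hypotheses (hmu : 0 <= mu) (hd : 0 <= d).

Let mtail (t : R) : measurable ([set x | t <= x] : set (measurableTypeR R)).
Proof. exact: measurable_tail. Qed.

Let lt_mad_ub (P : law R) : ambiguity_set mu b d P -> mu < b ->
  d < 2 * (b - mu).
Proof.
move=> AP mub; have := mad_le AP hmu.
have b0 : 0 < b by rewrite (le_lt_trans hmu).
rewrite -(ltr_pM2l b0); have : 0 < (b - mu) * (b - mu).
  by rewrite mulr_gt0// subr_gt0.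
lra.
Qed.

Let lt_mad_lb (P : law R) : ambiguity_set mu b d P -> 0 < mu -> d < 2 * mu.
Proof.
move=> AP mu0; have := mad_le AP hmu.
have b0 : 0 < b by rewrite (lt_le_trans mu0)// (mean_le_ub AP).
rewrite -(ltr_pM2l b0); have : 0 < mu * mu by rewrite mulr_gt0.
lra.
Qed.

Lemma worst_case_low t : 0 <= t <= tau1 mu b d ->
  worst_case mu b d t =
    [set P | ambiguity_set mu b d P /\ P `[t, b]%classic = 1%E].
Proof.
move=> /andP[t0 ttau]; apply: (@worst_case_eq _ _ _ _ _ 1).
- by move=> P AP; rewrite -lee_fin -law_fineK//; exact: probability_le1.
- by move=> P [].
- move=> [Q AQ].
  (* Atoms tau1 and b: tau1 is the largest left end point for which a law on
     [tau1, b] can have deviation d. If b = mu, then d = 0 and total division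
     gives q = 0 and tau1 = mu. *)
  set q := d / (2 * (b - mu)).
  have [/andP[q0 q1] taumu qmean qd] : [/\ 0 <= q <= 1, tau1 mu b d <= mu,
      (1 - q) * tau1 mu b d + q * b = mu & 2 * q * (b - mu) = d].
    have [mub|bmu] := ltP mu b.
      have db := lt_mad_ub AQ mub.
      have mub0 : 0 < b - mu by rewrite subr_gt0.
      have D0 : 0 < 2 * (b - mu) - d by rewrite subr_gt0.
      split.
      - by rewrite divr_ge0 ?ler_pdivrMr ?mul1r//=; lra.
      - by rewrite /tau1 lerBlDl lerDr divr_ge0 ?mulr_ge0// ltW.
      - by rewrite /q /tau1; field; rewrite !gt_eqF.
      - by rewrite /q; field; rewrite gt_eqF.
    have mub : b = mu by apply/eqP; rewrite eq_le bmu (mean_le_ub AQ).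
    have d0 : d = 0.
      by apply: le_anti; rewrite hd andbT; have := mad_le_ub AQ; lra.
    rewrite /q /tau1 d0 mub !(mul0r,subr0,add0r,mul1r,addr0,mulr0).
    by split=> //; rewrite lexx ler01.
  have [|||P AP PE] := @two_point_law R mu b d q (tau1 mu b d) b _ _ _ qmean qd.
  - by rewrite q0.
  - by rewrite taumu (le_trans t0).
  - by rewrite lexx (mean_le_ub AQ).
  exists P; split=> //; rewrite PE; congr EFin.
  rewrite !indicE !mem_set/= ?in_itv/= ?lexx ?ttau/=; first lra.
  - by rewrite (le_trans ttau)// (le_trans taumu)// (mean_le_ub AQ).
  - by rewrite (le_trans taumu)// (mean_le_ub AQ).
- move=> P AP; have [Pb _ _] := AP; rewrite (tail_itv Pb t0).
  split=> [P1|[_ ->]//].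
  by split=> //; rewrite law_fineK ?P1//; exact: measurable_itv.
Qed.

Lemma worst_case_above_mean t : 0 < mu -> mu <= t <= tau2 mu d ->
  worst_case mu b d t =
    [set P | [/\ ambiguity_set mu b d P, P [set 0] = (d / (2 * mu))%:E
               & P `[t, b]%classic = (1 - d / (2 * mu))%:E]].
Proof.
move=> mu0 /andP[mut ttau].
have mun0 : mu != 0 by rewrite gt_eqF.
have t0 : 0 <= t by rewrite (le_trans hmu).
set q := d / (2 * mu).
(* 1/2 + x / (2 mu) - |x - mu| / (2 mu) is min (x / mu) 1. *)
have gl x : x <= mu ->
    2^-1 + (2 * mu)^-1 * x + - (2 * mu)^-1 * `|x - mu| = x / mu.
  by move=> xm; rewrite ler0_norm ?subr_le0//; field.
have gr x : mu <= x ->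
    2^-1 + (2 * mu)^-1 * x + - (2 * mu)^-1 * `|x - mu| = 1.
  by move=> xm; rewrite ger0_norm ?subr_ge0//; field.
have dual P : ambiguity_set mu b d P ->
    fine (P [set x | t <= x]) <= 1 - q /\
    (fine (P [set x | t <= x]) = 1 - q ->
     P ([set 0] `|` `[t, b]%classic) = 1%E).
  move=> AP; have mub := mean_le_ub AP.
  have [] := @tail_duality _ _ _ _ _ AP 2^-1 (2 * mu)^-1 (- (2 * mu)^-1) 1 t.
    move=> x /andP[x0 xb]; rewrite mul1r.
    have [mux|xmu] := leP mu x.
      by rewrite gr//; case: (t <= x) => /=; rewrite ?subrr ?subr0.
    by rewrite gl ?(ltW xmu)// (lt_geF (lt_le_trans xmu mut)) subr0 divr_ge0.
  have -> : 2^-1 + (2 * mu)^-1 * mu + (- (2 * mu)^-1) * d = 1 - q.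
    by rewrite /q; field.
  rewrite mul1r => ? slack; split=> // /slack <-; congr (P _).
  apply/seteqP; split=> x /=; rewrite in_itv/=; last first.
  - rewrite mul1r => -[/andP[x0 xb]].
    have [mux|xmu] := leP mu x.
      by rewrite gr//; case: (t <= x) => /=; [right; rewrite xb|lra].
    rewrite gl ?(ltW xmu)// (lt_geF (lt_le_trans xmu mut)) => /eqP.
    by rewrite mulf_eq0 invr_eq0 (negbTE mun0) orbF => /eqP; left.
  - case=> [->|/andP[tx xb]].
      rewrite gl// mul0r (lt_geF (lt_le_trans mu0 mut)) mulr0 lexx.
      by rewrite (le_trans hmu).
    by rewrite (le_trans t0 tx) xb tx mulr1 gr// (le_trans mut).
apply: (@worst_case_eq _ _ _ _ _ (1 - q)).
- by move=> P /dual[].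
- by move=> P [].
- move=> [Q AQ].
  have dmu := lt_mad_lb AQ mu0; have mub := mean_le_ub AQ.
  have D0 : 0 < 2 * mu - d by rewrite subr_gt0.
  have tau2b : tau2 mu d <= b.
    rewrite /tau2 -lerBrDl ler_pdivrMr//; have := mad_le AQ hmu; lra.
  have q0 : 0 <= q by rewrite divr_ge0// mulr_ge0.
  have q1 : q <= 1 by rewrite ler_pdivrMr; lra.
  (* A single atom of mass 1 - q beside 0 has to be tau2 for the mean mu. *)
  have [|||||P AP PE] := @two_point_law R mu b d (1 - q) 0 (tau2 mu d).
  - lra.
  - by rewrite lexx.
  - by rewrite (le_trans mut).
  - by rewrite /q /tau2; field; rewrite gt_eqF.
  - by rewrite /q /tau2; field; rewrite gt_eqF.
  exists P; split=> //; rewrite PE; congr EFin; rewrite !indicE.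
  + rewrite mem_set// memNset/=; first lra.
    by apply/eqP; rewrite gt_eqF// (lt_le_trans mu0)// (le_trans mut).
  + rewrite memNset/= ?mem_set/= ?in_itv/= ?ttau//; first lra.
    by rewrite leNgt (lt_le_trans mu0).
- move=> P AP; have [Pb _ _] := AP.
  have [_ slack] := dual P AP; rewrite (tail_itv Pb t0) in slack *.
  split=> [Pt|[_ _ ->]//].
  have mtb : measurable (`[t, b]%classic : set (measurableTypeR R)).
    exact: measurable_itv.
  have PtE : P `[t, b]%classic = (1 - q)%:E by rewrite law_fineK// Pt.
  have m0 : measurable ([set 0] : set (measurableTypeR R)) by [].
  have dis : [set 0] `&` `[t, b]%classic = set0 :> set (measurableTypeR R).
    apply/seteqP; split=> // x [->].
    by rewrite /= in_itv/= leNgt (lt_le_trans mu0).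
  split=> //; have := slack Pt; rewrite (law_measureU P m0 mtb dis).
  by rewrite PtE (law_fineK P m0) -EFinD => -[?]; congr EFin; lra.
Qed.

Lemma worst_case_high t : mu < t -> tau2 mu d <= t <= b ->
  worst_case mu b d t =
    [set P | [/\ ambiguity_set mu b d P, P [set t] = (d / (2 * (t - mu)))%:E
               & P `[0, mu]%classic = (1 - d / (2 * (t - mu)))%:E]].
Proof.
move=> mut /andP[taut tb].
have t0 : 0 <= t by rewrite (le_trans hmu)// ltW.
have tmu0 : 0 < t - mu by rewrite subr_gt0.
have tmun0 : t - mu != 0 by rewrite gt_eqF.
(* k (x - mu + |x - mu|) is max (x - mu) 0 / (t - mu). *)
set k := (2 * (t - mu))^-1; set q := d * k.
have k0 : 0 < k by rewrite invr_gt0 mulr_gt0.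
have gl x : x <= mu -> - mu * k + k * x + k * `|x - mu| = 0.
  by move=> xm; rewrite ler0_norm ?subr_le0//; lra.
have gr x : mu <= x -> - mu * k + k * x + k * `|x - mu| = (x - mu) / (t - mu).
  by move=> xm; rewrite ger0_norm ?subr_ge0//; rewrite /k; field.
have mt : measurable ([set t] : set (measurableTypeR R)) by [].
have m0mu : measurable (`[0, mu]%classic : set (measurableTypeR R)).
  exact: measurable_itv.
have dis : [set t] `&` `[0, mu]%classic = set0 :> set (measurableTypeR R).
  apply/seteqP; split=> // x [->]; rewrite /= in_itv/= => /andP[_].
  by rewrite leNgt mut.
have dual P : ambiguity_set mu b d P ->
    fine (P [set x | t <= x]) <= q /\
    (fine (P [set x | t <= x]) = q -> P ([set t] `|` `[0, mu]%classic) = 1%E).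
  move=> AP.
  have [] := @tail_duality _ _ _ _ _ AP (- mu * k) k k 1 t.
    move=> x /andP[x0 xb]; rewrite mul1r.
    have [mux|xmu] := leP mu x; last first.
      by rewrite gl ?(ltW xmu)// (lt_geF (lt_trans xmu mut)) subr0.
    rewrite gr//; have [tx|xt] := leP t x; last first.
      by rewrite subr0 divr_ge0 ?subr_ge0// ltW.
    by rewrite subr_ge0 ler_pdivlMr// mul1r lerD2r.
  have -> : - mu * k + k * mu + k * d = q by rewrite /q; ring.
  rewrite mul1r => ? slack; split=> // /slack <-; congr (P _).
  apply/seteqP; split=> x /=; rewrite in_itv/= mul1r.
  - case=> [->|/andP[x0 xmu]].
      by rewrite t0 tb gr ?(ltW mut)// divff// lexx.
    rewrite gl// (lt_geF (le_lt_trans xmu mut)) x0 (le_trans xmu)//.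
    by rewrite (le_trans (ltW mut)).
  - move=> [/andP[x0 xb]].
    have [xmu|mux] := leP x mu; first by right; rewrite x0.
    rewrite gr ?(ltW mux)//; have [tx|xt] := leP t x.
      by move=> x1; left; have := divfK tmun0 (x - mu); rewrite x1 mul1r; lra.
    move/eqP; rewrite mulf_eq0 invr_eq0 (negbTE tmun0) orbF.
    by rewrite gt_eqF// subr_gt0.
apply: (@worst_case_eq _ _ _ _ _ q).
- by move=> P /dual[].
- by move=> P [].
- move=> [Q AQ].
  have mub := mean_le_ub AQ.
  have q0 : 0 <= q by rewrite mulr_ge0// ltW.
  have tq : t * q <= mu.
    rewrite /q /k mulrA ler_pdivrMr ?mulr_gt0//.
    have := hmu; rewrite le_eqVlt => /predU1P[mu0|mu0].
      have := mad_le_lb AQ hmu; rewrite -mu0 mulr0 => d0.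
      by rewrite mul0r mulr_ge0_le0.
    have D0 : 0 < 2 * mu - d by rewrite subr_gt0 (lt_mad_lb AQ).
    by move: taut; rewrite /tau2 -lerBrDl ler_pdivrMr//; lra.
  have tpos : 0 < t by rewrite (le_lt_trans hmu).
  have q1 : q < 1 by rewrite -(ltr_pM2l tpos) mulr1 (le_lt_trans tq).
  have q1' : 0 < 1 - q by rewrite subr_gt0.
  (* Mass q at t and mean mu leave the rest of the mass at y; y is nonnegative
     because t is at least tau2. *)
  set y := (mu - t * q) / (1 - q).
  have y0 : 0 <= y by rewrite divr_ge0 ?subr_ge0// ltW.
  have ymu : y <= mu.
    by rewrite ler_pdivrMr//; have := mulr_ge0 q0 (ltW tmu0); lra.
  have [|||||P AP PE] := @two_point_law R mu b d q y t.
  - by rewrite q0 ltW.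
  - by rewrite y0.
  - by rewrite ltW.
  - by rewrite /y; field; rewrite gt_eqF.
  - by rewrite /q /k; field.
  exists P; split=> //; rewrite PE; congr EFin; rewrite !indicE.
  + rewrite memNset/= ?mem_set//=; first by rewrite mulr0 add0r mulr1.
    by apply/eqP; rewrite lt_eqF// (le_lt_trans ymu).
  + have -> : (y \in `[0, mu]%classic) = true.
      by rewrite mem_set//= in_itv/= y0.
    have -> : (t \in `[0, mu]%classic) = false.
      by rewrite memNset//= in_itv/= (lt_geF mut) andbF.
    by rewrite mulr0 addr0 mulr1.
- move=> P AP; have [Pb _ _] := AP.
  have [Ple slack] := dual P AP.
  split=> [Pt|[_ Pt Pmu]]; last first.
    apply: le_anti; rewrite Ple -lee_fin -law_fineK// -Pt.
    by apply: le_measure; rewrite ?inE// => x -> /=; exact: lexx.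
  have PZ := slack Pt.
  have PtE : P [set t] = q%:E.
    have mZ := measurableU _ _ mt m0mu.
    rewrite -Pt -law_fineK// -(full_law_setI mZ (mtail t) PZ).
    congr (P _); apply/seteqP; split=> x /=.
      by move=> ->; split=> //; left.
    rewrite in_itv/= => -[tx [//|/andP[_ xmu]]].
    by have := le_trans tx xmu; rewrite leNgt mut.
  split=> //; move: PZ; rewrite (law_measureU P mt m0mu dis).
  by rewrite PtE (law_fineK P m0mu) -EFinD => -[?]; congr EFin; lra.
Qed.

Section three_point.
Variable t : R.
Hypotheses (t0 : 0 < t) (tmu : t <= mu).

Let p0 := 1 - mu / t + d * (b - t) / (2 * t * (b - mu)).
Let p1 := mu / t - b * d / (2 * t * (b - mu)).
Let p2 := d / (2 * (b - mu)).

Let m1 (x : R) : measurable ([set x] : set (measurableTypeR R)).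
Proof. by []. Qed.

Let mass_ge0 (P : law R) x p : P [set x] = p%:E -> 0 <= p.
Proof. by move=> Px; rewrite -lee_fin -Px measure_ge0. Qed.

(** If b <= mu, nonnegativity of the prescribed masses at 0 and b forces t = mu,
    and d = 0 unless b = mu, so all the mass is at t. This contradicts the
    support if t > b, and the zero mass prescribed at b if t = b. *)
Lemma three_point_mean_lt_ub P : three_point_laws mu b d t P -> mu < b.
Proof.
move=> [Pb P0 Pt P2]; rewrite ltNge; apply/negP => bmu.
have tn0 : t != 0 by rewrite gt_eqF.
have d0 : b != mu -> d = 0.
  move=> bn; have {}bmu : b < mu by rewrite lt_neqAle bn.
  apply: le_anti; rewrite hd andbT.
  have := mass_ge0 P2; rewrite ler_ndivlMr ?mul0r//; lra.
have z x : d * x / (b - mu) = 0.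
  have [->|/d0 ->] := eqVneq b mu; first by rewrite subrr invr0 mulr0.
  by rewrite !mul0r.
have tm : t = mu.
  apply: le_anti; rewrite tmu /=.
  have := mass_ge0 P0; rewrite -/p0 /p0.
  have -> : d * (b - t) / (2 * t * (b - mu)) = 0.
    by rewrite invfM mulrCA z mulr0.
  by rewrite addr0 subr_ge0 ler_pdivrMr// mul1r.
have Pt1 : P [set t] = 1%E.
  have p10 : b * d / (2 * t * (b - mu)) = 0.
    by rewrite invfM mulrCA (mulrC b) z mulr0.
  by rewrite Pt; congr EFin; rewrite p10 subr0 -tm divff.
have [bt|bt] := eqVneq b mu.
  move: P2; rewrite bt -tm Pt1 subrr mulr0 invr0 mulr0 => -[] /eqP.
  by rewrite oner_eq0.
have mD : measurable (`[0, b]%classic : set (measurableTypeR R)).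
  exact: measurable_itv.
have := full_law_setI mD (m1 t) Pb; rewrite Pt1.
rewrite (_ : _ `&` _ = set0) ?measure0; last first.
  apply/seteqP; split=> // x [->]; rewrite /= in_itv/= => /andP[_].
  by rewrite tm leNgt lt_neqAle bt bmu.
by move=> [] /esym/eqP; rewrite oner_eq0.
Qed.

(** The prescribed masses sum to 1, so they determine the law. The atom b, the
    only one above mu, carries half of the mean absolute deviation. *)
Lemma three_point_law_exists : mu < b -> 0 <= p0 -> 0 <= p1 ->
  exists F : law R,
    [/\ ambiguity_set mu b d F, three_point_laws mu b d t F,
        fine (F [set x | t <= x]) = 1 - p0 &
        forall P, three_point_laws mu b d t P -> same_law P F].
Proof.
move=> mub p00 p10.
have tb : t < b by rewrite (le_lt_trans tmu).
have b0 : 0 < b by rewrite (lt_trans t0).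
have mub0 : 0 < b - mu by rewrite subr_gt0.
have p20 : 0 <= p2 by rewrite divr_ge0// mulr_ge0// ltW.
pose s : seq (R * {nonneg R}) :=
  [:: (0, NngNum p00); (t, NngNum p10); (b, NngNum p20)].
have s1 : \sum_(p <- s) p.2%:num = 1.
  rewrite !big_cons big_nil/= /p0 /p1 /p2; field.
  by rewrite !gt_eqF.
have us : uniq (map fst s).
  by rewrite /= !inE !negb_or !lt_eqF.
have FE A : finite_law s A = (p0 * \1_A 0 + (p1 * \1_A t + p2 * \1_A b))%:E.
  by rewrite finite_lawE// !big_cons big_nil addr0.
have AF : ambiguity_set mu b d (finite_law s).
  apply: finite_law_ambiguity => //.
  - by move=> p; rewrite !inE => /or3P[] /eqP ->/=; rewrite ?lexx ?ltW.
  - rewrite !big_cons big_nil/= /p0 /p1 /p2; field.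
    by rewrite !gt_eqF.
  - rewrite !big_cons big_nil/= ler0_norm ?subr_le0// ler0_norm ?subr_le0//.
    rewrite gtr0_norm// /p0 /p1 /p2; field.
    by rewrite !gt_eqF.
have ind x y : \1_[set x] y = (y == x)%:R :> R.
  by rewrite indicE; congr (nat_of_bool _)%:R; apply/idP/eqP; rewrite inE.
exists (finite_law s); split=> //.
- split; first by case: AF.
  + rewrite FE; congr EFin; rewrite !ind eqxx !gt_eqF//= -/p0; lra.
  + rewrite FE; congr EFin; rewrite !ind eqxx lt_eqF// gt_eqF//= -/p1; lra.
  + rewrite FE; congr EFin; rewrite !ind eqxx !lt_eqF//= -/p2; lra.
- rewrite FE /= !indicE memNset/= ?mem_set/= ?(ltW tb)//.
    have : p0 + (p1 + p2) = 1 by move: s1; rewrite !big_cons big_nil addr0.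
    lra.
  by rewrite leNgt t0.
- move=> P [_ P0 P1 P2]; apply: same_law_finite_law => // p.
  by rewrite !inE => /or3P[] /eqP ->.
Qed.

(** The dominating function runs through (0, 0), (t, 1) and (b, 1), with its
    kink at mu. On [mu, b] it exceeds 1 by a multiple of (b - x) (mu - t): for
    t = mu it stays at 1 there, which is why slackness needs t < mu. *)
Lemma three_point_dual P : ambiguity_set mu b d P -> mu < b ->
  fine (P [set x | t <= x]) <= 1 - p0 /\
  (t < mu -> fine (P [set x | t <= x]) = 1 - p0 ->
   P ([set 0] `|` ([set t] `|` [set b])) = 1%E).
Proof.
move=> AP mub.
have mub0 : 0 < b - mu by rewrite subr_gt0.
have tn0 : t != 0 by rewrite gt_eqF.
have bn0 : b - mu != 0 by rewrite gt_eqF.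
(* c is the drop in slope at mu that brings F down to 1 at b. *)
set c := (b - t) / (t * (b - mu)).
pose g x := c * mu / 2 + (t^-1 - c / 2) * x + (- (c / 2)) * `|x - mu|.
have gl x : x <= mu -> g x = x / t.
  by move=> xm; rewrite /g ler0_norm ?subr_le0//; field.
have gr x : mu <= x -> g x = 1 + (b - x) * (mu - t) / (t * (b - mu)).
  by move=> xm; rewrite /g ger0_norm ?subr_ge0// /c; field; rewrite bn0.
have [] := @tail_duality _ _ _ _ _ AP
             (c * mu / 2) (t^-1 - c / 2) (- (c / 2)) 1 t.
  move=> x /andP[x0 xb]; rewrite mul1r -/(g x) subr_ge0.
  have [mux|xmu] := leP mu x.
    rewrite gr// (le_trans tmu mux) lerDl.
    by rewrite divr_ge0 ?mulr_ge0 ?subr_ge0 ?(ltW t0) ?(ltW mub).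
  rewrite gl ?(ltW xmu)//; have [tx|xt] := leP t x; last first.
    by rewrite divr_ge0// ltW.
  by rewrite ler_pdivlMr// mul1r.
have -> : c * mu / 2 + (t^-1 - c / 2) * mu + (- (c / 2)) * d = 1 - p0.
  by rewrite /p0 /c; field; rewrite bn0.
rewrite mul1r => ? slack; split=> // tltmu /slack <-; congr (P _).
have tb : t < b by rewrite (lt_trans tltmu).
apply/seteqP; split=> x /=; rewrite mul1r -/(g x).
- case=> [->|[->|->]].
  + by rewrite lexx (ltW (lt_trans t0 tb)) gl// mul0r (lt_geF t0).
  + by rewrite (ltW t0) (ltW tb) gl// divff// lexx.
  + rewrite lexx (ltW (lt_trans t0 tb)) gr ?(ltW mub)// (ltW tb).
    by rewrite subrr !mul0r addr0.
- move=> [/andP[x0 xb]].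
  have [mux|xmu] := leP mu x.
    rewrite gr// (le_trans tmu mux) -[RHS]addr0 => /addrI/eqP.
    rewrite !mulf_eq0 invr_eq0 mulf_eq0 (negbTE tn0) (negbTE bn0) !orbF.
    by rewrite !subr_eq0 (gt_eqF tltmu) orbF => /eqP; right; right.
  rewrite gl ?(ltW xmu)//; have [tx|xt] := leP t x => xt1.
    by right; left; have := divfK tn0 x; rewrite xt1 mul1r.
  by left; have := divfK tn0 x; rewrite xt1 mul0r.
Qed.

(** An extremal law is carried by {0, t, b}; its tail gives the mass at 0 and
    the sum of the other two, which the mean then separates. *)
Lemma three_point_slack P : ambiguity_set mu b d P -> mu < b -> t < mu ->
  fine (P [set x | t <= x]) = 1 - p0 -> three_point_laws mu b d t P.
Proof.
move=> AP mub tltmu Pt; have [_ /(_ tltmu Pt) PZ] := three_point_dual AP mub.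
have tb : t < b by rewrite (lt_trans tltmu).
have b0 : 0 < b by rewrite (lt_trans t0).
have tn0 : t != 0 by rewrite gt_eqF.
have bn0 : b - mu != 0 by rewrite subr_eq0 gt_eqF.
have m0tb : measurable ([set 0] `|` ([set t] `|` [set b])
    : set (measurableTypeR R)) by do 2?apply: measurableU.
have mtb : measurable ([set t] `|` [set b] : set (measurableTypeR R)).
  exact: measurableU.
pose w x := fine (P [set x]).
have wE x : P [set x] = (w x)%:E by rewrite (law_fineK P (m1 x)).
have PtbE : P ([set t] `|` [set b]) = (w t + w b)%:E.
  rewrite (law_measureU P (m1 t) (m1 b)) ?wE//.
  by apply/seteqP; split=> // x [->] /= /eqP; rewrite lt_eqF.
have wtb : w t + w b = 1 - p0.
  apply: EFin_inj; rewrite -PtbE -Pt -(law_fineK P (mtail t)).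
  rewrite -(full_law_setI m0tb (mtail t) PZ).
  congr (P _); apply/seteqP; split=> x /=.
    by case=> ->; rewrite ?(ltW tb) ?lexx; split=> //; right; [left|right].
  by move=> [tx [x0|//]]; move: tx; rewrite x0 leNgt t0.
have w0 : w 0 = p0.
  move: PZ; rewrite (law_measureU P (m1 0) mtb); last first.
    by apply/seteqP; split=> // x [->] /= [] /eqP; rewrite lt_eqF.
  rewrite PtbE wE -EFinD => -[]; lra.
have w_ge0 x : 0 <= w x by apply: (@mass_ge0 P x); rewrite wE.
pose s : seq (R * {nonneg R}) :=
  [:: (0, NngNum (w_ge0 0)); (t, NngNum (w_ge0 t)); (b, NngNum (w_ge0 b))].
have s1 : \sum_(p <- s) p.2%:num = 1 by rewrite !big_cons big_nil/=; lra.
have PF : same_law P (finite_law s).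
  apply: same_law_finite_law => //.
  - by rewrite /= !inE !negb_or !lt_eqF.
  - by move=> p; rewrite !inE => /or3P[] /eqP ->; rewrite wE.
have mean : w t * t + w b * b = mu.
  have [_ + _] := AP; rewrite (same_law_expectation _ PF).
  rewrite expectation_finite_law// !big_cons big_nil/= => -[]; lra.
have wb : w b = p2.
  have btn0 : b - t != 0 by rewrite subr_eq0 gt_eqF.
  apply: (mulIf btn0).
  have -> : w b * (b - t) = mu - t * (1 - p0) by rewrite -wtb -mean; ring.
  by rewrite /p0 /p2; field; rewrite bn0.
split; first by case: AP.
- by rewrite wE w0.
- rewrite wE; congr EFin; have -> : w t = 1 - p0 - p2 by lra.
  by rewrite /p0 /p2; field; rewrite bn0.
- by rewrite wE wb.
Qed.

Lemma three_point_law_tail P : three_point_laws mu b d t P ->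
  ambiguity_set mu b d P /\ fine (P [set x | t <= x]) = 1 - p0.
Proof.
move=> TP; have mub := three_point_mean_lt_ub TP.
have [_ P0 Pt _] := TP.
have [F [AF _ Ft PF]] := three_point_law_exists mub (mass_ge0 P0) (mass_ge0 Pt).
have {}PF := PF _ TP.
have [Fb Fmu Fd] := AF; split; last by rewrite PF.
split.
- by rewrite /laws_on /= PF//; exact: measurable_itv.
- by rewrite (same_law_expectation _ PF).
- by rewrite (same_law_expectation _ PF).
Qed.

Lemma three_point_worst_case :
  three_point_laws mu b d t `<=` worst_case mu b d t.
Proof.
move=> P TP; have mub := three_point_mean_lt_ub TP.
have [AP Pt] := three_point_law_tail TP.
by apply: (worst_case_of_bound _ AP Pt) => Q /three_point_dual /(_ mub)[].
Qed.

Lemma ambiguity_mean_lt_ub P : ambiguity_set mu b d P ->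
  tau1 mu b d <= t -> t < mu -> mu < b.
Proof.
move=> AP taut tltmu; rewrite lt_neqAle (mean_le_ub AP) andbT.
apply: contraTneq taut => mub.
by rewrite -ltNge /tau1 -mub subrr mulr0 mul0r subr0.
Qed.

Lemma three_point_law_of_ambiguity : tau1 mu b d <= t -> t < mu ->
  ambiguity_set mu b d !=set0 ->
  exists2 P, three_point_laws mu b d t P &
    forall Q, three_point_laws mu b d t Q -> same_law Q P.
Proof.
move=> taut tltmu [Q AQ]; have mub := ambiguity_mean_lt_ub AQ taut tltmu.
have mub0 : 0 < b - mu by rewrite subr_gt0.
have bn0 : b - mu != 0 by rewrite gt_eqF.
have tn0 : t != 0 by rewrite gt_eqF.
have den0 : 0 < 2 * t * (b - mu) by rewrite !mulr_gt0.
have p00 : 0 <= p0.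
  have -> : p0 = (d * (b - mu) - (mu - t) * (2 * (b - mu) - d))
                 / (2 * t * (b - mu)).
    by rewrite /p0; field; rewrite bn0.
  have D0 : 0 < 2 * (b - mu) - d by rewrite subr_gt0 (lt_mad_ub AQ).
  rewrite divr_ge0 ?(ltW den0)// subr_ge0 -ler_pdivlMr//.
  by move: taut; rewrite /tau1; lra.
have p10 : 0 <= p1.
  have -> : p1 = (2 * mu * (b - mu) - b * d) / (2 * t * (b - mu)).
    by rewrite /p1; field; rewrite bn0.
  by rewrite divr_ge0 ?(ltW den0)// subr_ge0 (mad_le AQ).
have [F [_ TF _ FE]] := three_point_law_exists mub p00 p10.
by exists F.
Qed.

Lemma worst_case_below_mean : tau1 mu b d <= t -> t < mu ->
  worst_case mu b d t = three_point_laws mu b d t.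
Proof.
move=> taut tltmu.
have mub P : ambiguity_set mu b d P -> mu < b.
  by move=> AP; exact: ambiguity_mean_lt_ub AP taut tltmu.
apply: (@worst_case_eq _ _ _ _ _ (1 - p0)).
- by move=> P AP; have [] := three_point_dual AP (mub _ AP).
- by move=> P /three_point_law_tail[].
- by move=> /(three_point_law_of_ambiguity taut tltmu)[P TP _]; exists P.
- move=> P AP; split; first exact: three_point_slack (mub _ AP) tltmu.
  by move=> /three_point_law_tail[].
Qed.

End three_point.
End cases.

Theorem proposition1 (R : realType) (mu b d : R)
    (hmu : 0 <= mu) (hb : 0 <= b) (hd : 0 <= d) :
  [/\ (* (i) *)
      forall t : R, 0 <= t <= tau1 mu b d ->
        worst_case mu b d t =
          [set P | ambiguity_set mu b d P /\ P `[t, b]%classic = 1%E],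
      (* (ii) *)
      forall t : R, tau1 mu b d <= t <= mu -> 0 < t ->
        three_point_laws mu b d t `<=` worst_case mu b d t /\
        (t < mu ->
           worst_case mu b d t = three_point_laws mu b d t /\
           (ambiguity_set mu b d !=set0 ->
              exists2 P, three_point_laws mu b d t P &
                forall Q, three_point_laws mu b d t Q -> same_law Q P)),
      (* (iii) *)
      0 < mu -> forall t : R, mu <= t <= tau2 mu d ->
        worst_case mu b d t =
          [set P | [/\ ambiguity_set mu b d P,
                       P [set 0] = (d / (2 * mu))%:E
                     & P `[t, b]%classic = (1 - d / (2 * mu))%:E]]
    & (* (iv) *)
      forall t : R, tau2 mu d <= t <= b -> mu < t ->
        worst_case mu b d t =
          [set P | [/\ ambiguity_set mu b d P,
                       P [set t] = (d / (2 * (t - mu)))%:E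
                     & P `[0, mu]%classic = (1 - d / (2 * (t - mu)))%:E]]].
Proof.
split.
- by move=> t; exact: worst_case_low.
- move=> t /andP[taut tmu] t0; split; first exact: three_point_worst_case.
  move=> tltmu; split; first exact: worst_case_below_mean.
  exact: three_point_law_of_ambiguity.
- by move=> mu0 t; exact: worst_case_above_mean.
- by move=> t taut mut; exact: worst_case_high.
Qed.
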